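(* Let $R$ be a finite Frobenius ring (not necessarily commutative) and let $w: R\to\mathbb{Q}$ be a weight on $R$ such that $G_{\mathrm{rt}}(w)=R^\times$ and $wf=w_{\mathrm{H}}$ for some function $f:R\to\mathbb{Q}$, where $w_{\mathrm{H}}$ is the Hamming weight on $R$. Then $w$ satisfies the Extension Property.
   Context: All rings are finite, associative, with identity $1$, not necessarily commutative; modules are unital. $R^\times$ is the group of units of $R$. A finite ring $R$ is Frobenius if ${}_RR\cong {}_R\widehat{R}$ as left $R$-modules, where $\widehat{R}=\mathrm{Hom}_{\mathbb{Z}}(R,\mathbb{C}^\times)$ is the character group of $(R,+)$ with left action $({}^r\chi)(x)=\chi(xr)$; equivalently, the left socle (sum of all minimal left ideals) is a principal left ideal. A weight on $R$ is any function $w: R \to \mathbb{Q}$; it is extended to $R^n$ by $w(x)=\sum_{i=1}^n w(x_i)$. The Hamming weight is $w_{\mathrm{H}}(0)=0$ and $w_{\mathrm{H}}(x)=1$ for $x\ne 0$. For a weight $w$ and a function $f:R\to\mathbb{Q}$, the weight $wf$ is defined by $(wf)(x)=\sum_{r\in R} w(rx)\,f(r)$. The right symmetry group of $w$ is $G_{\mathrm{rt}}(w)=\{v\in R^\times : w(xv)=w(x) \text{ for all } x\in R\}$. A linear code of length $n$ is a left submodule $C\le {}_RR^n$. A $w$-isometry is a left $R$-linear map $\varphi: C\to {}_RR^n$ with $w(\varphi(x))=w(x)$ for all $x\in C$. A $G_{\mathrm{rt}}(w)$-monomial transformation of $R^n$ is a map $\Phi(x_1,\dots,x_n)=(x_{\pi(1)}u_1,\dots,x_{\pi(n)}u_n)$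 with $\pi\in S_n$ and $u_1,\dots,u_n\in G_{\mathrm{rt}}(w)$. $R$ and $w$ satisfy the Extension Property if for every $n\ge 1$ and every linear code $C\le {}_RR^n$, every injective $w$-isometry $\varphi: C\to {}_RR^n$ is the restriction to $C$ of a $G_{\mathrm{rt}}(w)$-monomial transformation of $R^n$. *)

(* Defs.v *)
(* Mathematical Components, with the complex numbers over Stdlib's reals. *)
From HB Require Import structures.
From mathcomp Require Import all_boot all_order all_algebra all_fingroup.
From mathcomp Require Import complex Rstruct.

Set Implicit Arguments.
Unset Strict Implicit.
Unset Printing Implicit Defensive.

Import GRing.Theory.
Local Open Scope ring_scope.

(* Rings are of type [finPzRingType]: noncommutative, and the zero ring is
   allowed. *)

Notation Cplx := (complex Rdefinitions.R).

(* Homomorphisms from (R, +) to the multiplicative group of nonzero complex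
   numbers. *)
Definition is_addchar (R : finPzRingType) (chi : {ffun R -> Cplx}) : bool :=
  [forall x, chi x != 0] && [forall x, forall y, chi (x + y) == chi x * chi y].

Record addchar (R : finPzRingType) := AddChar {
  addchar_val :> {ffun R -> Cplx};
  _ : is_addchar addchar_val
}.

HB.instance Definition _ R := [isSub for @addchar_val R].
HB.instance Definition _ R := [Choice of addchar R by <:].

Section CharacterModule.
Variable R : finPzRingType.
Implicit Types (chi psi : addchar R) (r x y : R).

Lemma addchar_neq0 chi x : chi x != 0.
Proof. by case: chi => f /= /andP[/forallP]. Qed.

Lemma addcharD chi x y : chi (x + y) = chi x * chi y.
Proof. by case: chi => f /= /andP[_ /forallP/(_ x)/forallP/(_ y)/eqP]. Qed.

Lemma addcharP chi psi : (forall x, chi x = psi x) -> chi = psi.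
Proof. by move=> e; apply/val_inj/ffunP. Qed.

Lemma is_addcharI (f : R -> Cplx) :
    (forall x, f x != 0) -> (forall x y, f (x + y) = f x * f y) ->
  is_addchar (finfun f).
Proof.
move=> f0 fD; apply/andP; split; first by apply/forallP=> x; rewrite ffunE.
by apply/forallP=> x; apply/forallP=> y; rewrite !ffunE fD.
Qed.

(* The group law of the character group is the pointwise product; it is
   written additively, as for any [lmodType]. *)
Fact addchar_one_subproof : is_addchar (finfun (fun _ : R => 1 : Cplx)).
Proof. by apply: is_addcharI => *; rewrite ?oner_neq0 ?mulr1. Qed.
Definition addchar_one : addchar R := AddChar addchar_one_subproof.

Fact addchar_mul_subproof chi psi :
  is_addchar (finfun (fun x => chi x * psi x)).
Proof.
apply: is_addcharI => [x|x y]; first by rewrite mulf_neq0 ?addchar_neq0.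
by rewrite !addcharD mulrACA.
Qed.
Definition addchar_mul chi psi : addchar R :=
  AddChar (addchar_mul_subproof chi psi).

Fact addchar_inv_subproof chi : is_addchar (finfun (fun x => (chi x)^-1)).
Proof.
apply: is_addcharI => [x|x y]; first by rewrite invr_eq0 addchar_neq0.
by rewrite addcharD invfM.
Qed.
Definition addchar_inv chi : addchar R := AddChar (addchar_inv_subproof chi).

Fact addchar_scale_subproof r chi : is_addchar (finfun (fun x => chi (x * r))).
Proof.
apply: is_addcharI => [x|x y]; first exact: addchar_neq0.
by rewrite mulrDl addcharD.
Qed.
Definition addchar_scale r chi : addchar R :=
  AddChar (addchar_scale_subproof r chi).

Fact addchar_mulA : associative addchar_mul.
Proof. by move=> a b c; apply: addcharP => x; rewrite !ffunE mulrA. Qed.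
Fact addchar_mulC : commutative addchar_mul.
Proof. by move=> a b; apply: addcharP => x; rewrite !ffunE mulrC. Qed.
Fact addchar_mul1 : left_id addchar_one addchar_mul.
Proof. by move=> a; apply: addcharP => x; rewrite !ffunE mul1r. Qed.
Fact addchar_mulV : left_inverse addchar_one addchar_inv addchar_mul.
Proof.
by move=> a; apply: addcharP => x; rewrite !ffunE mulVf ?addchar_neq0.
Qed.

HB.instance Definition _ := GRing.isZmodule.Build (addchar R)
  addchar_mulA addchar_mulC addchar_mul1 addchar_mulV.

Fact addchar_scaleA a b chi :
  addchar_scale a (addchar_scale b chi) = addchar_scale (a * b) chi.
Proof. by apply: addcharP => x; rewrite !ffunE mulrA. Qed.
Fact addchar_scale1 : left_id 1 addchar_scale.
Proof. by move=> chi; apply: addcharP => x; rewrite !ffunE mulr1. Qed.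
Fact addchar_scaleDr : right_distributive addchar_scale +%R.
Proof. by move=> a chi psi; apply: addcharP => x; rewrite !ffunE. Qed.
Fact addchar_scaleDl chi : {morph addchar_scale^~ chi : a b / a + b}.
Proof.
by move=> a b; apply: addcharP => x; rewrite !ffunE mulrDr addcharD.
Qed.

HB.instance Definition _ := GRing.Zmodule_isLmodule.Build R (addchar R)
  addchar_scaleA addchar_scale1 addchar_scaleDr addchar_scaleDl.

End CharacterModule.

Definition frobenius_ring (R : finPzRingType) : Prop :=
  exists psi : {linear R^o -> addchar R}, bijective psi.

(* [GRing.unit] is only available for nonzero rings. *)
Definition ring_units (R : finPzRingType) : {set R} :=
  [set u | [exists v, (u * v == 1) && (v * u == 1)]].

Definition weightn (R : finPzRingType) (w : R -> rat) n (x : 'rV[R]_n) : rat :=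
  \sum_(i < n) w (x 0 i).

Definition hamming_weight (R : finPzRingType) (x : R) : rat := (x != 0)%:R.

Definition weight_mul (R : finPzRingType) (w f : R -> rat) (x : R) : rat :=
  \sum_(r : R) w (r * x) * f r.

Definition right_symmetry (R : finPzRingType) (w : R -> rat) : {set R} :=
  [set v in ring_units R | [forall x, w (x * v) == w x]].

Definition linear_code (R : finPzRingType) n (C : {set 'rV[R]_n}) : Prop :=
  GRing.submod_closed C.

(* A map on the code C is represented by a function on the whole space; only its
   restriction to C is constrained or used. *)
Definition linear_on (R : finPzRingType) n (C : {set 'rV[R]_n})
    (phi : 'rV[R]_n -> 'rV[R]_n) : Prop :=
  forall a : R, {in C &, forall x y, phi (a *: x + y) = a *: phi x + phi y}.

Definition isometry_on (R : finPzRingType) (w : R -> rat) n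
    (C : {set 'rV[R]_n}) (phi : 'rV[R]_n -> 'rV[R]_n) : Prop :=
  linear_on C phi /\ {in C, forall x, weightn w (phi x) = weightn w x}.

Definition monomial_transformation (R : finPzRingType) (G : {set R}) n
    (Phi : 'rV[R]_n -> 'rV[R]_n) : Prop :=
  exists (pi : 'S_n) (u : 'I_n -> R),
    (forall i, u i \in G) /\
    (forall x, Phi x = \row_(i < n) (x 0 (pi i) * u i)).

Definition extension_property (R : finPzRingType) (w : R -> rat) : Prop :=
  forall (n : nat) (C : {set 'rV[R]_n}) (phi : 'rV[R]_n -> 'rV[R]_n),
    (0 < n)%N -> linear_code C -> isometry_on w C phi ->
    {in C &, injective phi} ->
  exists2 Phi : 'rV[R]_n -> 'rV[R]_n,
    monomial_transformation (right_symmetry w) Phi & {in C, phi =1 Phi}.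

(* Main.v *)
(* Since w f = w_H, a linear w-isometry preserves the Hamming weight, and the
   claim becomes MacWilliams' extension theorem. Let l_i and m_i be the
   coordinate functionals of the inclusion of C and of phi, and chi a generating
   character of R. As the sum of chi (y r) over r is |R| if y = 0 and 0
   otherwise, equality of Hamming weights turns into an equality of sums of
   characters chi (l_i(x) r) and chi (m_i(x) r) of C; orthogonality then shows
   that l_i r = v and m_i r = v have equally many solutions (i, r) for every
   functional v. By triangularity the families of right submodules l_i R and
   m_i R agree up to order, and over a finite ring two generators of the same
   cyclic module differ by a unit. *)
Require Import Defs.
From mathcomp Require Import all_boot all_order all_algebra.
From mathcomp Require Import all_fingroup complex Rstruct.

Set Implicit Arguments.
Unset Strict Implicit.
Unset Printing Implicit Defensive.

Import GRing.Theory Num.Theory.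
Local Open Scope ring_scope.

(** * Cyclic right submodules and their generators *)

Section RightScaling.
Variables (R : finPzRingType) (T : finType).
Implicit Types (u v y : {ffun T -> R}) (r s t : R) (A Z : {set R}).

Definition rscale v r : {ffun T -> R} := [ffun x => v x * r].

Definition rcyclic v : {set {ffun T -> R}} := [set rscale v r | r : R].

Lemma rscaleA v r s : rscale (rscale v r) s = rscale v (r * s).
Proof. by apply/ffunP=> x; rewrite !ffunE mulrA. Qed.

Lemma rscale1 v : rscale v 1 = v.
Proof. by apply/ffunP=> x; rewrite ffunE mulr1. Qed.

Lemma rscaleD v r s : rscale v (r + s) = rscale v r + rscale v s.
Proof. by apply/ffunP=> x; rewrite !ffunE mulrDr. Qed.

Lemma rscaleB v r s : rscale v (r - s) = rscale v r - rscale v s.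
Proof. by apply/ffunP=> x; rewrite !ffunE mulrBr. Qed.

Lemma rcyclic_refl v : v \in rcyclic v.
Proof. by apply/imsetP; exists 1; rewrite ?rscale1. Qed.

Lemma rcyclicS u v : u \in rcyclic v -> rcyclic u \subset rcyclic v.
Proof.
case/imsetP=> r _ ->; apply/subsetP=> _ /imsetP[s _ ->].
by rewrite rscaleA imset_f.
Qed.

Definition left_ideal A : Prop :=
  {in A &, forall a b, a - b \in A} /\ forall r, {in A, forall a, r * a \in A}.

Lemma left_ideal_imset u v A :
  left_ideal A -> u \in rcyclic v -> rscale u @: A \subset rscale v @: A.
Proof.
case=> _ Am /imsetP[r _ ->]; apply/subsetP=> _ /imsetP[a Aa ->].
by rewrite rscaleA imset_f ?Am.
Qed.

(** The nonempty fibres of the additive map [rscale v] on [A] are cosets of its kernel in [A], so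
    all have the same size. *)
Lemma card_rscale_fiber v y A : left_ideal A ->
  (#|[set t in A | rscale v t == y]| * #|rscale v @: A|
   = (y \in rscale v @: A) * #|A|)%N.
Proof.
case=> AB Am.
have AD : {in A &, forall a b, a + b \in A}.
  by move=> a b Aa Ab; rewrite -[b]opprK -[- b]mulN1r AB // Am.
have fib t0 : t0 \in A -> #|[set t in A | rscale v t == rscale v t0]|
    = #|[set t in A | rscale v t == 0]|.
  move=> At0; rewrite -[RHS](card_imset _ (addIr t0)); apply: eq_card => t.
  rewrite !inE; apply/andP/imsetP => [[At /eqP e]|[s]].
    by exists (t - t0); rewrite ?subrK // inE AB //= rscaleB e subrr.
  by rewrite inE => /andP[As /eqP e] ->; rewrite AD // rscaleD e add0r.
have [/imsetP[t0 At0 ->]|yN] := boolP (y \in _); last first.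
  rewrite mul0n (_ : [set t in A | _] = set0) ?cards0 //.
  apply/setP=> t; rewrite !inE; apply/andP=> -[At /eqP e].
  by case/negP: yN; rewrite -e imset_f.
rewrite fib // mul1n -[RHS]sum1_card (partition_big (rscale v) [in rscale v @: A]) /=.
  rewrite (eq_bigr (fun=> #|[set t in A | rscale v t == 0%R]|)).
    by rewrite sum_nat_const mulnC.
  move=> _ /imsetP[t At ->]; rewrite -(fib t) // -sum1_card.
  by apply: eq_bigl => s; rewrite inE.
by move=> a Aa; rewrite imset_f.
Qed.

(** If [u = v r], then [u A = v (r A)] lies in [v A] because [A] is a left ideal. By symmetry the
    images agree, and they determine the fibre sizes. *)
Lemma eq_card_rscale_fiber u v y A : left_ideal A -> rcyclic u = rcyclic v ->
  #|[set t in A | rscale u t == y]| = #|[set t in A | rscale v t == y]|.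
Proof.
move=> AI euv.
have eI : rscale u @: A = rscale v @: A.
  apply/eqP; rewrite eqEsubset !left_ideal_imset //.
    by rewrite euv rcyclic_refl.
  by rewrite -euv rcyclic_refl.
have := card_rscale_fiber u y AI; have := card_rscale_fiber v y AI.
rewrite eI; have [y_in|yN] := boolP (y \in _).
  move=> <- /eqP; rewrite eqn_pmul2r; last by apply/card_gt0P; exists y.
  by move/eqP.
have E0 w : rscale w @: A = rscale v @: A -> [set t in A | rscale w t == y] = set0.
  move=> ew; apply/setP=> t; rewrite !inE; apply/andP=> -[At /eqP e].
  by case/negP: yN; rewrite -ew -e imset_f.
by rewrite !E0.
Qed.

Definition rann t : {set R} := [set z | t * z == 0].

Lemma left_ideal_annihilator Z : left_ideal [set t | Z \subset rann t].
Proof.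
split=> [a b|r a]; rewrite !inE.
  move=> /subsetP Za /subsetP Zb; apply/subsetP=> z zZ.
  by move: (Za z zZ) (Zb z zZ); rewrite !inE mulrBl => /eqP-> /eqP->; rewrite subrr.
move=> /subsetP Za; apply/subsetP=> z zZ.
by move: (Za z zZ); rewrite !inE -mulrA => /eqP->; rewrite mulr0.
Qed.

Lemma rann0_unit t : rann t = [set 0] -> t \in ring_units R.
Proof.
move=> t0.
have tI : injective ( *%R t).
  move=> a b e; apply/eqP; rewrite -subr_eq0 -in_set1 -t0 inE.
  by rewrite mulrBr e subrr.
have [g _ gK] := injF_bij tI.
rewrite inE; apply/existsP; exists (g 1); rewrite gK eqxx /=.
by apply/eqP/tI; rewrite mulrA gK mul1r mulr1.
Qed.

(* Counting solutions [t] of [u t = v] by annihilator: for every [Z] the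
   solutions killing [Z] are as many as those of [v t = v], so by inclusion-
   exclusion the same holds for the solutions with annihilator exactly [0],
   and [t = 1] is such a solution of [v t = v]. *)
Lemma rcyclic_associated u v : rcyclic u = rcyclic v ->
  exists2 c, c \in ring_units R & v = rscale u c.
Proof.
move=> euv.
pose N w Z := #|[set t | (rann t == Z) && (rscale w t == v)]|.
have NE w Z : #|[set t in [set t | Z \subset rann t] | rscale w t == v]|
    = (N w Z + \sum_(Y : {set R} | Z \proper Y) N w Y)%N.
  transitivity (\sum_(Y : {set R} | Z \subset Y) N w Y)%N.
    rewrite -sum1_card (partition_big rann [pred Y : {set R} | Z \subset Y]) /=.
      apply: eq_bigr => Y ZY; rewrite /N -sum1_card; apply: eq_bigl => t.
      by rewrite !inE; have [->|_] := eqVneq (rann t) Y; rewrite ?ZY ?andbT ?andbF.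
    by move=> t; rewrite !inE => /andP[].
  rewrite (bigD1 Z) //=; congr (_ + _)%N; apply: eq_bigl => Y.
  by rewrite properEneq eq_sym andbC.
have Neq Z : N u Z = N v Z.
  (* Descending induction on [Z]: the terms of strictly larger sets cancel. *)
  have [k] := ubnP #|~: Z|; elim: k Z => // k IH Z ltk.
  have := eq_card_rscale_fiber v (left_ideal_annihilator Z) euv.
  rewrite !NE [X in (_ + X)%N](eq_bigr (N v)); first by move/addIn.
  move=> Y ZY; apply: IH; apply: leq_trans (ltk : (_ <= k)%N).
  by apply: proper_card; rewrite properC.
have : (0 < N u [set 0%R])%N.
  rewrite Neq; apply/card_gt0P; exists 1.
  rewrite inE rscale1 eqxx andbT; apply/eqP/setP=> z.
  by rewrite !inE mul1r.
case/card_gt0P=> c; rewrite inE => /andP[/eqP c0 /eqP ec].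
by exists c => //; apply: rann0_unit.
Qed.

Lemma left_idealT : left_ideal [set: R].
Proof. by split=> [? ? _ _|? ? _]; rewrite inE. Qed.

(* Triangularity: [v] is a right multiple of [w] only if [w] generates a larger
   submodule, so a largest submodule with different multiplicities in the two
   families would contradict the hypothesis at its generator. *)
Lemma perm_rcyclic (l m : seq {ffun T -> R}) :
    {in l ++ m, forall v,
       (\sum_(w <- l) #|[set r | rscale w r == v]|
        = \sum_(w <- m) #|[set r | rscale w r == v]|)%N} ->
  perm_eq (map rcyclic l) (map rcyclic m).
Proof.
move=> lm; apply/allP=> I; rewrite -map_cat => /mapP[v v_in ->{I}]; apply/eqP.
have [k] := ubnP #|~: rcyclic v|; elim: k v v_in => // k IH v v_in ltk.
(* The number of [r] with [w r = v] depends only on [J = rcyclic w]: a fibre of [R -> J] has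
   [#|R| / #|J|] elements. *)
pose F (J : {set {ffun T -> R}}) := ((v \in J) * #|R| %/ #|J|)%N.
have FE w : #|[set r | rscale w r == v]| = F (rcyclic w).
  have := card_rscale_fiber w v left_idealT; rewrite cardsT.
  have -> : rscale w @: [set: R] = rcyclic w.
    by apply/setP=> y; apply/imsetP/imsetP => -[r _ ->]; exists r.
  rewrite /F => <-; rewrite mulnK; first by apply: eq_card => r; rewrite !inE.
  by apply/card_gt0P; exists w; apply: rcyclic_refl.
have sumE q : (\sum_(w <- q) #|[set r | rscale w r == v]|
    = \sum_J count_mem J (map rcyclic q) * F J)%N.
  under eq_bigr do rewrite FE.
  rewrite -(big_map rcyclic predT F) (partition_big id predT) //=.
  apply: eq_bigr => J _; rewrite (eq_bigr (fun=> F J)) => [|K /eqP-> //].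
  by rewrite big_const_seq iter_addn_0 mulnC.
have := lm v v_in; rewrite !sumE (bigD1 (rcyclic v)) //=.
rewrite [X in _ = X -> _](bigD1 (rcyclic v)) //=.
rewrite [X in (_ + X)%N](eq_bigr
  (fun J => count_mem J (map rcyclic m) * F J)%N).
  move/addIn/eqP; rewrite eqn_pmul2r ?(eqP _) // => [/eqP //|].
  rewrite -FE; apply/card_gt0P; exists 1.
  by rewrite inE rscale1.
(* If [J] contains [v] and occurs in a family, it strictly contains [rcyclic v], so the induction
   hypothesis applies at a generator of [J]. *)
move=> J Jv; have [vJ|vJ] := boolP (v \in J); last first.
  by rewrite /F (negPf vJ) mul0n div0n !muln0.
congr (_ * _)%N; have [|JN] := boolP (J \in map rcyclic (l ++ m)).
  case/mapP=> w w_in eJ; rewrite eJ; apply: IH => //.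
  apply: leq_trans (ltk : (_ <= k)%N); apply: proper_card.
  by rewrite properC properEneq eq_sym -eJ Jv eJ rcyclicS // -eJ.
move: JN; rewrite map_cat mem_cat negb_or => /andP[Jl Jm].
by rewrite !(count_memPn _).
Qed.

End RightScaling.

(** * Character sums and the generating character *)

Lemma sum_character_eq0 (K : idomainType) (V : finZmodType) (C : {set V})
    (h : V -> K) x0 :
    (forall x, (x0 + x \in C) = (x \in C)) -> x0 \in C ->
    {in C &, {morph h : x y / x + y >-> x * y}} -> h x0 != 1 ->
  \sum_(x in C) h x = 0.
Proof.
move=> C_x0 x0C hD h_x0; set S := \sum_(x in C) _.
(* Translation by [x0] permutes [C]. *)
have : S = h x0 * S.
  rewrite {1}/S (reindex_inj (addrI x0)) /= mulr_sumr.
  by apply: eq_big => [x|x]; rewrite C_x0 //; apply: hD.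
move/eqP; rewrite -subr_eq0 -{1}[S]mul1r -mulrBl mulf_eq0 subr_eq0 eq_sym.
by rewrite (negPf h_x0) => /eqP.
Qed.

Lemma addchar0 (R : finPzRingType) (chi : addchar R) : chi 0 = 1.
Proof.
by apply: (mulfI (addchar_neq0 chi 0)); rewrite -addcharD addr0 mulr1.
Qed.

Section GeneratingCharacter.
Variables (R : finPzRingType) (psi : {linear R^o -> addchar R}).
Hypothesis psi_inj : injective psi.

Let chi (x : R) : Cplx := psi (1 : R) x.

Lemma generating_characterE r x : psi r x = chi (x * r).
Proof. by rewrite -[r in LHS]mulr1 linearZ /= ffunE. Qed.

Let chiD x y : chi (x + y) = chi x * chi y. Proof. exact: addcharD. Qed.

Let chi0 : chi 0 = 1. Proof. exact: addchar0. Qed.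

(** If [chi] were trivial on the left ideal [R t], then [psi t] would equal [psi 0], against
    injectivity. *)
Lemma generating_character_nontrivial t : t != 0 -> exists y, psi (1 : R) (y * t) != 1.
Proof.
move=> t0; apply/existsP; apply: contraR t0 => /existsPn chi1.
apply/eqP/psi_inj/addcharP => x; rewrite !generating_characterE mulr0 chi0.
by apply/eqP; move: (chi1 x); rewrite negbK.
Qed.

(* Injectivity of [psi] gives orthogonality of the characters [psi r], that is,
   a one-sided inverse of the square matrix [chi (x r)]; being two-sided, it
   yields orthogonality in the other variable. *)
Lemma sum_generating_character y :
  \sum_s psi (1 : R) (y * s) = (y == 0)%:R * #|R|%:R.
Proof.
have card0 : #|R|%:R != 0 :> Cplx.
  by rewrite pnatr_eq0 -lt0n; apply/card_gt0P; exists 0.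
pose e (i : 'I_#|R|) : R := enum_val i.
pose P := \matrix_(i, j) chi (e j * e i).
pose Q := \matrix_(i, j) (chi (- (e i * e j)) / #|R|%:R).
have sum_e (F : R -> Cplx) : \sum_i F (e i) = \sum_x F x.
  rewrite [RHS](reindex e) //=.
  by exists enum_rank => x _; rewrite /e ?enum_valK ?enum_rankK.
have PQ : P *m Q = 1%:M.
  apply/matrixP=> i j; rewrite !mxE.
  under eq_bigr do rewrite !mxE mulrA -chiD -mulrBr.
  rewrite -mulr_suml (sum_e (fun x => chi (x * (e i - e j)))).
  have [->|ij] := eqVneq i j.
    under eq_bigr do rewrite subrr mulr0 chi0.
    by rewrite sumr_const divff.
  have [|y0 hy0] := generating_character_nontrivial (t := e i - e j).
    by rewrite subr_eq0 (inj_eq enum_val_inj).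
  rewrite (eq_bigl [in [set: R]]) => [|x]; last by rewrite inE.
  rewrite (sum_character_eq0 (x0 := y0)) ?mul0r ?inE //.
    by move=> x; rewrite !inE.
  by move=> x z _ _; rewrite mulrDl chiD.
(* The row of [Q] at [0] is constantly [1 / #|R|], so this entry of [Q *m P] is the wanted sum over
   [#|R|]. *)
have /matrixP/(_ (enum_rank 0) (enum_rank y)) := mulmx1C PQ.
rewrite !mxE (inj_eq enum_rank_inj) eq_sym => <-.
rewrite mulr_suml -sum_e; apply: eq_bigr => i _; rewrite !mxE /e !enum_rankK.
by rewrite mul0r oppr0 chi0 mul1r mulrC mulrA divff ?mul1r.
Qed.

End GeneratingCharacter.

(** * From equal zero counts to a monomial transformation *)

Section HammingIsometry.
Variables (R : finPzRingType) (hR : frobenius_ring R).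
Variables (V : finZmodType) (scaleV : R -> V -> V) (C : {set V}).
Hypothesis C_0 : 0 \in C.
Hypothesis C_add : {in C &, forall x y, x + y \in C}.
Hypothesis C_opp : {in C, forall x, - x \in C}.
Hypothesis C_scale : forall a, {in C, forall x, scaleV a x \in C}.

(** Extension by zero outside [C] makes equality of functions on [V] the same as equality on [C]. *)
Definition linear_functional (v : {ffun V -> R}) : Prop :=
  [/\ {in [predC C], forall x, v x = 0},
      {in C &, {morph v : x y / x + y}}
    & forall a, {in C, forall x, v (scaleV a x) = a * v x}].

(* The sum over [C] of the character [x |-> chi (w x r - v x)] is [#|C|] if
   [w r = v] and [0] otherwise, so summing over [w] and [r] recovers the number
   of solutions of [w r = v] from the numbers of [w] vanishing at each point. *)
Lemma sum_card_rscale_fiber (l m : seq {ffun V -> R}) v :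
    {in l ++ m, forall w, linear_functional w} -> linear_functional v ->
    {in C, forall x, count (fun w : {ffun V -> R} => w x == 0) l
                     = count (fun w : {ffun V -> R} => w x == 0) m} ->
  (\sum_(w <- l) #|[set r | rscale w r == v]|
   = \sum_(w <- m) #|[set r | rscale w r == v]|)%N.
Proof.
case: hR => psi /bij_inj psi_inj lmL [v0 vD vZ] lm.
pose chi := psi (1 : R).
have orth w r : linear_functional w ->
    \sum_(x in C) chi (w x * r - v x) = (rscale w r == v)%:R * #|C|%:R.
  case=> w0 wD wZ; have [e|ne] := eqVneq.
    rewrite mul1r -sumr_const; apply: eq_bigr => x _.
    by rewrite -e ffunE subrr addchar0.
  rewrite mul0r.
  have [x ne_x] : exists x, w x * r - v x != 0.
    apply/existsP; apply: contraR ne => /existsPn e; apply/eqP/ffunP=> x.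
    by rewrite ffunE; apply/eqP; rewrite -subr_eq0; move: (e x); rewrite negbK.
  have xC : x \in C.
    by apply: contraR ne_x => xN; rewrite w0 ?v0 ?inE // mul0r subrr.
  (* By left linearity, replacing [x] by [a x] multiplies [w x * r - v x] by [a] on the left, which
     yields a point where the character is not [1]. *)
  have [a ha] := generating_character_nontrivial psi_inj ne_x.
  apply: (sum_character_eq0 (x0 := scaleV a x)).
  - move=> y; apply/idP/idP => yC; last by rewrite C_add ?C_scale.
    by rewrite -[y](addKr (scaleV a x)) C_add ?C_opp ?C_scale.
  - exact: C_scale.
  - move=> y z yC zC /=; rewrite -addcharD wD // vD // mulrDl opprD.
    by rewrite addrACA.
  by rewrite wZ // vZ // -mulrA -mulrBr.
have fiberE q : {in q, forall w, linear_functional w} ->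
    (\sum_(w <- q) #|[set r | rscale w r == v]|)%:R * #|C|%:R
    = \sum_(x in C) chi (- v x) * ((count (fun w : {ffun V -> R} => w x == 0) q)%:R * #|R|%:R).
  move=> qL; transitivity (\sum_(w <- q) \sum_r \sum_(x in C) chi (w x * r - v x)).
    rewrite natr_sum mulr_suml; apply: eq_big_seq => w /qL wL.
    rewrite -sum1_card natr_sum big_mkcond mulr_suml; apply: eq_bigr => r _.
    by rewrite orth // inE; case: eqP.
  under eq_bigr do rewrite exchange_big /=.
  rewrite exchange_big /=; apply: eq_bigr => x _.
  rewrite -sum1_count natr_sum mulr_suml mulr_sumr [RHS]big_mkcond /=.
  apply: eq_bigr => w _; under eq_bigr do rewrite addcharD mulrC.
  rewrite -mulr_sumr sum_generating_character //.
  by case: eqP => _; rewrite ?mul0r ?mulr0.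
have cardC : #|C|%:R != 0 :> Cplx.
  by rewrite pnatr_eq0 -lt0n; apply/card_gt0P; exists 0.
apply/eqP; rewrite -(eqr_nat Cplx) -(inj_eq (mulIf cardC)) !fiberE.
- by apply/eqP/eq_bigr => x xC; rewrite lm.
- by move=> w wm; apply: lmL; rewrite mem_cat wm orbT.
by move=> w wl; apply: lmL; rewrite mem_cat wl.
Qed.

Lemma eq_zero_counts_monomial n (l m : n.-tuple {ffun V -> R}) :
    (forall i, linear_functional (tnth l i)) ->
    (forall i, linear_functional (tnth m i)) ->
    {in C, forall x, count (fun w : {ffun V -> R} => w x == 0) l
                     = count (fun w : {ffun V -> R} => w x == 0) m} ->
  exists pi : 'S_n, exists2 u : 'I_n -> R,
    forall i, u i \in ring_units R
    & forall i, tnth m i = rscale (tnth l (pi i)) (u i).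
Proof.
move=> lL mL lm.
have lmL : {in l ++ m, forall w, linear_functional w}.
  by move=> w; rewrite mem_cat => /orP[] /tnthP[i ->].
have : perm_eq (map_tuple (@rcyclic _ _) m) (map_tuple (@rcyclic _ _) l).
  rewrite perm_sym; apply: perm_rcyclic => v /lmL vL.
  exact: sum_card_rscale_fiber.
case/tuple_permP=> pi /val_inj e; exists pi.
have assoc i : exists2 c : R, c \in ring_units R
    & tnth m i = rscale (tnth l (pi i)) c; last exact: fin_all_exists2 assoc.
apply: rcyclic_associated; move/(congr1 (fun q => tnth q i)): e.
by rewrite tnth_mktuple !tnth_map.
Qed.

End HammingIsometry.

(** * Reduction to the Hamming weight and the extension theorem *)

Lemma weightn_scale_sum (R : finPzRingType) (w f : R -> rat) n (x : 'rV[R]_n) :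
  weightn (weight_mul w f) x = \sum_r weightn w (r *: x) * f r.
Proof.
rewrite /weightn /weight_mul exchange_big; apply: eq_bigr => r _ /=.
by rewrite mulr_suml; apply: eq_bigr => i _; rewrite mxE.
Qed.

Theorem corollary2p2 (R : finPzRingType) (w : R -> rat)
    (hR : frobenius_ring R)
    (hG : right_symmetry w = ring_units R)
    (hf : exists f : R -> rat, forall x : R, weight_mul w f x = hamming_weight x) :
  extension_property w.
Proof.
move=> n C phi _ [C0 Clin] [phiL phiw] _.
have [f fH] := hf.
have CZ a : {in C, forall x, a *: x \in C}.
  by move=> x xC; rewrite -[_ *: _]addr0 Clin.
have CD : {in C &, forall x y, x + y \in C}.
  by move=> x y xC yC; rewrite -[x]scale1r Clin.
have CN : {in C, forall x, - x \in C}.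
  by move=> x xC; rewrite -scaleN1r CZ.
have phiD : {in C &, forall x y, phi (x + y) = phi x + phi y}.
  by move=> x y xC yC; rewrite -[x in LHS]scale1r phiL // scale1r.
have phi0 : phi 0 = 0.
  by apply: (addrI (phi 0)); rewrite -phiD // !addr0.
have phiZ a : {in C, forall x, phi (a *: x) = a *: phi x}.
  by move=> x xC; rewrite -[_ *: x]addr0 phiL // phi0 addr0.
pose coords (g : 'rV[R]_n -> 'rV[R]_n) :=
  [tuple [ffun x => if x \in C then g x 0 i else 0] | i < n].
have countE g : {in C, forall x,
    count (fun v : {ffun 'rV[R]_n -> R} => v x == 0) (coords g)
    = count (fun i => g x 0 i == 0) (enum 'I_n)}.
  by move=> x xC; rewrite /= count_map; apply: eq_count => i; rewrite /= ffunE xC.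
pose l := coords id; pose m := coords phi.
(* This turns equality of Hamming weights into equality of zero counts. *)
have weightE (x : 'rV[R]_n) : weightn (@hamming_weight R) x
    + (count (fun i => x 0 i == 0) (enum 'I_n))%:R = n%:R.
  rewrite -[n in RHS]size_enum_ord -sum1_count -sum1_size !natr_sum.
  rewrite !big_enum_cond big_mkcond -big_split /=; apply: eq_big => // i _.
  by rewrite /hamming_weight; case: eqP => _; rewrite ?addr0 ?add0r.
have phiH : {in C, forall x,
    weightn (@hamming_weight R) (phi x) = weightn (@hamming_weight R) x}.
  move=> x xC; have wE y : weightn (@hamming_weight R) y = weightn (weight_mul w f) y.
    by apply: eq_bigr => i _; rewrite fH.
  (* The weight [w f] combines the [w]-weights of the multiples [r *: x], each preserved by the
     linear isometry [phi]. *)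
  rewrite !wE !weightn_scale_sum; apply: eq_bigr => r _.
  by rewrite -phiZ // phiw // CZ.
have lm : {in C, forall x,
    count (fun v : {ffun 'rV[R]_n -> R} => v x == 0) l
    = count (fun v : {ffun 'rV[R]_n -> R} => v x == 0) m}.
  move=> x xC; rewrite !countE //; apply/eqP; rewrite -(eqr_nat rat).
  rewrite -(inj_eq (addrI (weightn (@hamming_weight R) x))) weightE.
  by rewrite -phiH // weightE.
pose scale (a : R) (x : 'rV[R]_n) := a *: x.
have linearE g i : {in C &, forall x y, g (x + y) = g x + g y} ->
    (forall a, {in C, forall x, g (a *: x) = a *: g x}) ->
    linear_functional scale C (tnth (coords g) i).
  rewrite tnth_mktuple => gD gZ.
  split=> [x /negPf xN|x y xC yC|a x xC]; rewrite !ffunE.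
  - by rewrite xN.
  - by rewrite xC yC CD // gD // mxE.
  - by rewrite xC CZ // gZ // mxE.
have [pi [u uU e]] : exists pi : 'S_n, exists2 u : 'I_n -> R,
    forall i, u i \in ring_units R
    & forall i, tnth m i = rscale (tnth l (pi i)) (u i).
  by apply: (@eq_zero_counts_monomial _ hR _ scale C) => // i; apply: linearE.
exists (fun x => \row_i (x 0 (pi i) * u i)).
  by exists pi, u; split=> // i; rewrite hG.
move=> x xC; apply/rowP=> i; rewrite mxE.
by have /ffunP/(_ x) := e i; rewrite !tnth_mktuple !ffunE xC.
Qed.
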